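(* Let $\mathcal G=(V,E)$ be a finite graph, $T$ a finite set of tiles on $\mathcal G$, $w:T\to\mathbb R_{>0}$ a weight function, and $P=\sum_{t\in T}w_t\prod_{v\in V}\frac{x_v^{t_v}}{t_v!}$ the tiling polynomial. Then, as formal power series in the variables $(x_v)_{v\in V}$, $$\exp(P)=\sum_{\mathbf N\in(\mathbb Z_{\ge 0})^V} Z(w,\mathbf N)\,\frac{\prod_{v\in V}x_v^{N_v}}{\prod_{v\in V}N_v!}.$$ Moreover, for each integer $K\ge 0$, if $Z_K(w,\mathbf N)$ denotes the sum of the weights $w(m)$ over those $\mathbf N$-fold tilings $m$ which use exactly $K$ tiles in total, then $$\frac{P^K}{K!}=\sum_{\mathbf N\in(\mathbb Z_{\ge 0})^V} Z_K(w,\mathbf N)\,\frac{\prod_{v\in V}x_v^{N_v}}{\prod_{v\in V}N_v!}.$$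
   Context: A tile $t$ on $\mathcal G$ is a (nonempty) multiset of vertices of $\mathcal G$: each vertex $v\in V$ has a multiplicity $t_v\in\mathbb Z_{\ge0}$ in $t$. For a vector of multiplicities $\mathbf N=(N_v)_{v\in V}$ of nonnegative integers, the blow-up $\mathcal G_{\mathbf N}$ is the graph obtained from $\mathcal G$ by replacing each vertex $v$ by $N_v$ vertices (lying above $v$) and each edge $uv$ by the complete bipartite graph $K_{N_u,N_v}$. A lift of a tile $t$ to $\mathcal G_{\mathbf N}$ is a choice, for each $v\in V$, of a set of $t_v$ distinct vertices of $\mathcal G_{\mathbf N}$ lying above $v$ (together with the induced subgraph). An $\mathbf N$-fold tiling is a partition of the vertex set of $\mathcal G_{\mathbf N}$ into disjoint sets, each of which is the vertex set of a lift of a tile of $T$. $\Omega(\mathbf N)$ is the set of $\mathbf N$-fold tilings. The weight of $m\in\Omega(\mathbf N)$ is $w(m)=\prod_{t\in T}w_t^{m(t)}$, where $m(t)$ is the number of lifts of $t$ used in $m$, and $Z(w,\mathbf N)=\sum_{m\in\Omega(\mathbf N)}w(m)$ is the partition function. *)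

(* Defs.v *)
From HB Require Import structures.
From mathcomp Require Import all_boot all_order all_algebra finmap.
From mathcomp Require Import boolp classical_sets functions cardinality fsbigop.
From mathcomp Require Import reals.

Set Implicit Arguments.
Unset Strict Implicit.
Unset Printing Implicit Defensive.

Import Order.TTheory GRing.Theory Num.Theory.

Local Open Scope ring_scope.

(** * Formal power series in the variables (x_i)_{i : I} *)

(* f : fps I R stands for the formal sum of the f N * prod_i x_i ^ (N i), over
   all exponent vectors N. *)
Definition fps (I : finType) (R : Type) := {ffun I -> nat} -> R.

HB.instance Definition _ (I : finType) (R : comNzRingType) :=
  GRing.Zmodule.copy (fps I R) ({ffun I -> nat} -> R).

Section FpsRing.
Variables (I : finType) (R : comNzRingType).
Implicit Types (f g h : fps I R) (N : {ffun I -> nat}).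

Definition fps_one : fps I R := fun N => (N == 0)%:R.

(* The sum is finite, as its index set is. *)
Definition fps_mul f g : fps I R := fun N =>
  \sum_(p \in [set p : {ffun I -> nat} * {ffun I -> nat} | p.1 + p.2 = N]%classic)
    f p.1 * g p.2.

Definition fps_scale (a : R) f : fps I R := fun N => a * f N.

Let box d := {ffun I -> 'I_d.+1}.
Let ex d (b : box d) : {ffun I -> nat} := [ffun i => b i : nat].
Let bounded d N := forall i, (N i <= d)%N.

Let ex_inj d : injective (@ex d).
Proof.
by move=> a b /ffunP e; apply/ffunP => i; have := e i; rewrite !ffunE => /val_inj.
Qed.

Let exP d N : bounded d N -> exists b : box d, ex b = N.
Proof.
move=> dN; exists [ffun i => inord (N i)]; apply/ffunP => i.
by rewrite !ffunE inordK // ltnS.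
Qed.

Let ex_bounded d (b : box d) : bounded d (ex b).
Proof. by move=> i; rewrite ffunE -ltnS. Qed.

Let boundedD d N M : bounded d (N + M) -> bounded d N /\ bounded d M.
Proof.
move=> dNM; split=> i; apply: leq_trans (dNM i); rewrite ffunE.
  exact: leq_addr.
exact: leq_addl.
Qed.

Let bounded_deg N : bounded (\sum_i N i) N.
Proof. by move=> i; rewrite (bigD1 i) //= leq_addr. Qed.

Let fps_mulE d f g N : bounded d N -> fps_mul f g N =
  \sum_(a : box d) \sum_(b : box d | ex a + ex b == N) f (ex a) * g (ex b).
Proof.
move=> dN; rewrite /fps_mul pair_big_dep /=.
set r := [seq (ex p.1, ex p.2) | p <- enum [pred p : box d * box d |
                                            ex p.1 + ex p.2 == N]].
have -> : [set p | p.1 + p.2 = N]%classic = [set` r]%classic.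
  apply/seteqP; split=> -[a b] /=.
    move=> abN; rewrite -abN in dN.
    have [/exP[a' a'E] /exP[b' b'E]] := boundedD dN.
    apply/mapP; exists (a', b'); last by rewrite /= a'E b'E.
    by rewrite mem_enum inE /= a'E b'E abN.
  by move=> /mapP[[a' b']]; rewrite mem_enum inE /= => /eqP <- [-> ->].
rewrite -fsbig_seq; first by rewrite big_map big_enum.
rewrite map_inj_uniq ?enum_uniq // => -[a b] [a' b'] /=.
by move=> [] /ex_inj-> /ex_inj->.
Qed.

Fact fps_mulA : associative fps_mul.
Proof.
move=> f g h; apply/funext => N; set d := (\sum_i N i)%N.
have dN : bounded d N by exact: bounded_deg.
have sumE (M : {ffun I -> nat}) (P : pred (box d)) (F : {ffun I -> nat} -> R) :
    bounded d M -> (forall a, P a = (ex a == M)) ->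
    \sum_(a | P a) F (ex a) = F M.
  move=> /exP[m <-] PE; rewrite (big_pred1 m) // => a.
  by rewrite PE /= (inj_eq (@ex_inj d)).
transitivity (\sum_(a : box d) \sum_(b : box d)
    \sum_(c : box d | ex a + ex b + ex c == N) f (ex a) * g (ex b) * h (ex c)).
  rewrite (fps_mulE _ _ dN); apply: eq_bigr => a _.
  transitivity (\sum_(s : box d | ex a + ex s == N) \sum_(b : box d)
    \sum_(c : box d | ex b + ex c == ex s) f (ex a) * g (ex b) * h (ex c)).
    apply: eq_bigr => s _; rewrite (fps_mulE _ _ (ex_bounded s)) mulr_sumr.
    apply: eq_bigr => b _; rewrite mulr_sumr.
    by apply: eq_bigr => c _; rewrite mulrA.
  rewrite exchange_big /=; apply: eq_bigr => b _.
  rewrite (exchange_big_dep xpredT) //= [RHS]big_mkcond /=.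
  apply: eq_bigr => c _; case: ifPn => [/eqP abc|abc]; last first.
    by rewrite big_pred0 // => s; apply/negbTE; apply: contra abc =>
      /andP[/eqP<- /eqP<-]; rewrite addrA.
  apply: (sumE (ex b + ex c) _ (fun=> f (ex a) * g (ex b) * h (ex c))).
    by have [] := @boundedD d (ex a) (ex b + ex c); rewrite // addrA abc.
  move=> s; apply/andP/eqP => [[_ /eqP->]//|->].
  by rewrite addrA abc !eqxx.
rewrite (fps_mulE _ _ dN).
transitivity (\sum_(s : box d) \sum_(c : box d | ex s + ex c == N)
   \sum_(a : box d) \sum_(b : box d | ex a + ex b == ex s)
     f (ex a) * g (ex b) * h (ex c)); last first.
  apply: eq_bigr => s _; apply: eq_bigr => c _.
  rewrite (fps_mulE _ _ (ex_bounded s)) mulr_suml.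
  by apply: eq_bigr => a _; rewrite mulr_suml.
under [RHS]eq_bigr do rewrite exchange_big /=.
rewrite [RHS]exchange_big /=; apply: eq_bigr => a _.
under [RHS]eq_bigr do rewrite (exchange_big_dep xpredT) //=.
rewrite [RHS](exchange_big_dep xpredT) //=; apply: eq_bigr => b _.
under [RHS]eq_bigr do rewrite big_mkcondl.
rewrite (exchange_big_dep xpredT) //= [LHS]big_mkcond /=.
apply: eq_bigr => c _; rewrite -big_mkcondr /=.
case: ifPn => [/eqP abc|abc]; last first.
  by rewrite big_pred0 // => s; apply/negbTE; apply: contra abc =>
      /andP[/eqP-> /eqP->].
apply/esym/(sumE (ex a + ex b) _ (fun=> f (ex a) * g (ex b) * h (ex c))).
  by have [] := @boundedD d (ex a + ex b) (ex c); rewrite // abc.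
move=> s; apply/andP/eqP => [[/eqP->]//|->].
by rewrite abc !eqxx.
Qed.

Fact fps_mulC : commutative fps_mul.
Proof.
move=> f g; apply/funext => N; rewrite !(fps_mulE _ _ (@bounded_deg N)).
rewrite (exchange_big_dep xpredT) //=; apply: eq_bigr => a _.
by apply: eq_big => [b|b _]; rewrite 1?addrC 1?mulrC.
Qed.

Fact fps_mul1 : left_id fps_one fps_mul.
Proof.
move=> f; apply/funext => N; rewrite (fps_mulE _ _ (@bounded_deg N)).
have [z z0] : exists z : box (\sum_i N i)%N, ex z = 0.
  by apply: exP => i; rewrite ffunE.
have [n nN] := exP (@bounded_deg N).
rewrite (bigD1 z) //= [X in _ + X]big1 => [|a az]; last first.
  rewrite big1 // => b _; rewrite /fps_one -z0 (inj_eq (@ex_inj _)).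
  by rewrite (negbTE az) mul0r.
rewrite addr0 z0 (big_pred1 n) => [|b]; last first.
  by rewrite add0r /= -[RHS](inj_eq (@ex_inj _)) nN.
by rewrite nN /fps_one eqxx mul1r.
Qed.

Fact fps_mulDl : left_distributive fps_mul +%R.
Proof.
move=> f g h; apply/funext => N.
have -> : (fps_mul f h + fps_mul g h) N = fps_mul f h N + fps_mul g h N by [].
rewrite !(fps_mulE _ _ (@bounded_deg N)) -big_split; apply: eq_bigr => a _.
by rewrite -big_split; apply: eq_bigr => b _; exact: mulrDl.
Qed.

Fact fps_one_neq0 : fps_one != 0.
Proof.
apply/eqP => /(congr1 (fun f : fps I R => f 0)).
by rewrite /fps_one eqxx => /eqP; rewrite oner_eq0.
Qed.

HB.instance Definition _ := GRing.Zmodule_isComNzRing.Build (fps I R)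
  fps_mulA fps_mulC fps_mul1 fps_mulDl fps_one_neq0.

Fact fps_scaleA a b f : fps_scale a (fps_scale b f) = fps_scale (a * b) f.
Proof. by apply/funext => N; rewrite /fps_scale mulrA. Qed.

Fact fps_scale1 : left_id 1 fps_scale.
Proof. by move=> f; apply/funext => N; rewrite /fps_scale mul1r. Qed.

Fact fps_scaleDr : right_distributive fps_scale +%R.
Proof. by move=> a f g; apply/funext => N; exact: mulrDr. Qed.

Fact fps_scaleDl f : {morph fps_scale^~ f : a b / a + b}.
Proof. by move=> a b; apply/funext => N; exact: mulrDl. Qed.

HB.instance Definition _ := GRing.Zmodule_isLmodule.Build R (fps I R)
  fps_scaleA fps_scale1 fps_scaleDr fps_scaleDl.

Fact fps_scaleAl (a : R) f g : a *: (f * g) = a *: f * g.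
Proof.
apply/funext => N; have -> : (a *: (f * g)) N = a * fps_mul f g N by [].
have -> : ((a *: f) * g) N = fps_mul (fps_scale a f) g N by [].
rewrite !(fps_mulE _ _ (@bounded_deg N)) mulr_sumr; apply: eq_bigr => b _.
by rewrite mulr_sumr; apply: eq_bigr => c _; rewrite mulrA.
Qed.

HB.instance Definition _ :=
  GRing.Lmodule_isLalgebra.Build R (fps I R) fps_scaleAl.
HB.instance Definition _ := GRing.Lalgebra_isComAlgebra.Build R (fps I R).

Definition fps_X (i : I) : fps I R := fun N => (N == [ffun j => (j == i : nat)])%:R.

(* If f has constant term 0, then f ^+ k has no term of degree less than k, so
   only finitely many powers of f contribute to a given coefficient of exp f. *)
Lemma fps_expr_coef0 f N k :
  f 0 = 0 -> (\sum_i N i < k)%N -> (f ^+ k) N = 0.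
Proof.
move=> f0; elim: k N => // k IH N Nk; rewrite exprS.
have -> : (f * f ^+ k) N = fps_mul f (f ^+ k) N by [].
rewrite (fps_mulE _ _ (@bounded_deg N)) big1 // => a _.
rewrite big1 // => b /eqP abN.
have [a0|a0] := eqVneq (ex a) 0; first by rewrite a0 f0 mul0r.
rewrite IH ?mulr0 //; apply: leq_trans (_ : (\sum_i N i <= k)%N) => //.
rewrite [X in (_ < X)%N](eq_bigr (fun i => ex a i + ex b i)%N) => [|i _]; last first.
  by move/ffunP/(_ i): abN => <-; rewrite ffunE.
rewrite big_split /= -[X in (X < _)%N]add0n ltn_add2r lt0n sum_nat_eq0.
apply: contra a0 => /forallP a0; apply/eqP/ffunP => i.
by rewrite [RHS]ffunE; exact/eqP/(implyP (a0 i)).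
Qed.

End FpsRing.

(* The sum over k is a finite-support sum, equal by convention to 0 if the
   support is infinite; fps_expr_coef0 rules this out when f 0 = 0. *)
Definition fps_exp (I : finType) (R : fieldType) (f : fps I R) : fps I R :=
  fun N => \sum_(k \in [set: nat]%classic) (k`!%:R^-1 *: f ^+ k) N.

(** * Graphs, blow-ups and tilings *)

Record sgraph := SGraph {
  vertex :> finType;
  edge : rel vertex;
  edge_sym : symmetric edge;
  edge_irr : irreflexive edge
}.

Section Blowup.
Variables (G : sgraph) (N : {ffun G -> nat}).

Definition blowup_vertex : finType := {v : G & 'I_(N v)}.
Definition blowup_edge : rel blowup_vertex := fun x y => edge (tag x) (tag y).

Fact blowup_edge_sym : symmetric blowup_edge.
Proof. by move=> x y; exact: edge_sym. Qed.

Fact blowup_edge_irr : irreflexive blowup_edge.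
Proof. by move=> x; exact: edge_irr. Qed.

Definition blowup : sgraph := SGraph blowup_edge_sym blowup_edge_irr.

Definition above (x : blowup) : G := tag (x : blowup_vertex).

End Blowup.

Definition tile (G : sgraph) := {t : {ffun G -> nat} | [exists v, (0 < t v)%N]}.

Section Tilings.
Variables (G : sgraph) (N : {ffun G -> nat}).

(* A lift is an induced subgraph of the blow-up, hence given by its vertex set. *)
Definition is_lift (t : tile G) (S : {set blowup N}) :=
  [forall v, #|[set x in S | above x == v]%SET| == val t v].

Definition tilings (T : {fset tile G}) : {set {set {set blowup N}}} :=
  [set m : {set {set blowup N}} | finset.partition m [set: blowup N]
    && [forall S in m, exists t : T, is_lift (val t) S]]%SET.

Definition tile_count (m : {set {set blowup N}}) (t : tile G) : nat :=
  #|[set S in m | is_lift t S]%SET|.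

Definition tiling_weight (R : realType) (T : {fset tile G}) (w : T -> R)
    (m : {set {set blowup N}}) : R :=
  \prod_(t : T) w t ^+ tile_count m (val t).

End Tilings.

Definition partition_function (G : sgraph) (R : realType) (T : {fset tile G})
    (w : T -> R) (N : {ffun G -> nat}) : R :=
  \sum_(m in tilings N T) tiling_weight w m.

(* A tiling m is a set of lifts, so #|m| is the total number of tiles it uses. *)
Definition partition_function_card (G : sgraph) (R : realType)
    (T : {fset tile G}) (w : T -> R) (K : nat) (N : {ffun G -> nat}) : R :=
  \sum_(m in tilings N T | #|m| == K) tiling_weight w m.

Definition tiling_polynomial (G : sgraph) (R : realType) (T : {fset tile G})
    (w : T -> R) : fps G R :=
  \sum_(t : T) w t *:
    \prod_(v : G) ((val (val t) v)`!%:R^-1 *: fps_X R v ^+ val (val t) v).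

(* Main.v *)
(* Colour a finite set X by the vertices of G, and let g be a function of the
   colour counts with g 0 = 0. Summing the products of the g-values of the blocks
   over all partitions of a subset D of X into K blocks gives N!/K! times the
   coefficient at N of the K-th power of the exponential generating series of g,
   where N is the colour count of D: removing a block gives a recurrence in K,
   and the number of subsets of D with colour count a is the product of the
   binomials (N_v choose a_v). For g a = the sum of the w_t over the tiles t = a,
   the series is P and, on the blow-up coloured by the vertex lying below, the
   sum over the partitions is Z_K. *)
Require Import Defs.
From mathcomp Require Import boolp classical_sets fsbigop.
From mathcomp Require Import all_boot all_order all_algebra finmap.
From mathcomp Require Import reals.
From mathcomp Require Import ring.

Set Implicit Arguments.
Unset Strict Implicit.
Unset Printing Implicit Defensive.

Import Order.TTheory GRing.Theory Num.Theory.
Local Open Scope ring_scope.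

(** * Exponent vectors, their factorials and binomials *)

Section Exponents.
Variable I : finType.
Implicit Types N a : {ffun I -> nat}.

(** A finite type for the exponent vectors bounded by [N] in each coordinate, so that the sums
    giving coefficients of products become ordinary finite sums. *)
Definition exp_box N := {dffun forall i : I, 'I_(N i).+1}.

Definition exp_of N (b : exp_box N) : {ffun I -> nat} := [ffun i => b i : nat].

Definition exp_sub N a : {ffun I -> nat} := [ffun i => (N i - a i)%N].

Definition exp_fact N : nat := \prod_i (N i)`!.

Lemma exp_of_inj N : injective (@exp_of N).
Proof.
by move=> a b /ffunP e; apply/ffunP => i; have := e i; rewrite !ffunE => /val_inj.
Qed.

Lemma exp_of_le N (b : exp_box N) i : (exp_of b i <= N i)%N.
Proof. by rewrite ffunE -ltnS. Qed.

Lemma exp_ofP N a : (forall i, a i <= N i)%N -> exists b : exp_box N, exp_of b = a.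
Proof.
move=> aN; exists [ffun i => inord (a i)]; apply/ffunP => i.
by rewrite !ffunE inordK // ltnS.
Qed.

Lemma exp_subK N a : (forall i, a i <= N i)%N -> a + exp_sub N a = N.
Proof. by move=> aN; apply/ffunP => i; rewrite !ffunE; exact: subnKC. Qed.

Lemma exp_fact_gt0 N : (0 < exp_fact N)%N.
Proof. by apply: prodn_gt0 => i; exact: fact_gt0. Qed.

Lemma exp_fact_binomial N a : (forall i, a i <= N i)%N ->
  exp_fact N = (\prod_i 'C(N i, a i) * (exp_fact a * exp_fact (exp_sub N a)))%N.
Proof.
move=> aN; rewrite /exp_fact -!big_split; apply: eq_bigr => i _ /=.
by rewrite ffunE bin_fact.
Qed.

End Exponents.

(** * Coefficients of products and monomials of power series *)

Section PowerSeries.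
Variables (I : finType) (R : comNzRingType).
Implicit Types (f g : fps I R) (N a : {ffun I -> nat}).

(** The pairs of exponents with sum [N] are exactly the pairs [(a, N - a)] with [a] in the box below
    [N]. *)
Lemma fps_coefM f g N :
  (f * g) N = \sum_(b : exp_box N) f (exp_of b) * g (exp_sub N (exp_of b)).
Proof.
rewrite [LHS]/(fps_mul f g N) /fps_mul.
set r := [seq (exp_of b, exp_sub N (exp_of b)) | b <- enum {: exp_box N}].
have -> : [set p | p.1 + p.2 = N]%classic = [set` r]%classic.
  apply/seteqP; split=> -[a c] /=.
    move=> /ffunP acN; have aN i : (a i <= N i)%N.
      by rewrite -acN ffunE; exact: leq_addr.
    have [b bE] := exp_ofP aN; apply/mapP; exists b; rewrite ?mem_enum // bE.
    by congr pair; apply/ffunP => i; rewrite ffunE -acN ffunE /= addKn.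
  by move=> /mapP[b _ [-> ->]]; apply/exp_subK/exp_of_le.
rewrite -fsbig_seq; first by rewrite big_map big_enum.
by rewrite map_inj_uniq ?enum_uniq // => b b' [] /exp_of_inj.
Qed.

Lemma fps_coefZ (x : R) f N : (x *: f) N = x * f N.
Proof. by []. Qed.

Lemma fps_coef_sum (J : finType) (P : pred J) (F : J -> fps I R) N :
  (\sum_(j | P j) F j) N = \sum_(j | P j) F j N.
Proof. by elim/big_rec2: _ => // j x y _ <-. Qed.

Definition fps_monom a : fps I R := fun N => (N == a)%:R.

Lemma fps_monom0 : fps_monom 0 = 1.
Proof. by []. Qed.

Lemma fps_monomD a b : fps_monom (a + b) = fps_monom a * fps_monom b.
Proof.
apply/funext => N; rewrite fps_coefM /fps_monom.
have [->|NE] := eqVneq N (a + b); last first.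
  rewrite big1 // => c _; have [ca|_] := eqVneq (exp_of c) a; rewrite ?mul0r //.
  rewrite mul1r; have [cb|//] := eqVneq _ b.
  by rewrite -(exp_subK (exp_of_le c)) cb ca eqxx in NE.
have [i|c cE] := @exp_ofP _ (a + b) a; first by rewrite ffunE leq_addr.
rewrite (bigD1 c) //= big1 ?addr0 => [|c']; last first.
  by rewrite -(inj_eq (@exp_of_inj _ _)) cE => /negbTE->; rewrite mul0r.
rewrite cE eqxx mul1r; case: eqP => // -[]; apply/ffunP => i.
by rewrite !ffunE /= addKn.
Qed.

Lemma fps_monomMn a n : fps_monom (a *+ n) = fps_monom a ^+ n.
Proof. by elim: n => // n IH; rewrite mulrS exprS fps_monomD IH. Qed.

Lemma fps_monom_sum (F : I -> {ffun I -> nat}) :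
  fps_monom (\sum_i F i) = \prod_i fps_monom (F i).
Proof. by apply: (big_morph _ fps_monomD). Qed.

(** The vector [a] is the sum of the unit vectors with multiplicities [a i], and [fps_monom] turns
    sums into products. *)
Lemma fps_monomE a : fps_monom a = \prod_i fps_X R i ^+ a i.
Proof.
have aE : a = \sum_i [ffun j => (j == i : nat)] *+ a i.
  apply/ffunP => j; rewrite sum_ffunE (bigD1 j) //= big1 ?addr0.
    by rewrite ffunMnE ffunE eqxx; elim: (a j) => // n; rewrite mulrS => <-.
  by move=> i ij; rewrite ffunMnE ffunE eq_sym (negbTE ij) mul0rn.
rewrite {1}aE fps_monom_sum; apply: eq_bigr => i _; by rewrite fps_monomMn.
Qed.

End PowerSeries.

(** * Subsets of a coloured set, counted by colour *)

Section Colouring.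
Variables (I X : finType) (c : X -> I).
Implicit Types D S : {set X}.

Definition colour_count D : {ffun I -> nat} :=
  [ffun i => #|[set x in D | c x == i]%SET|].

Lemma colour_count_le D S : S \subset D ->
  forall i, (colour_count S i <= colour_count D i)%N.
Proof.
move=> SD i; rewrite !ffunE; apply/subset_leq_card/subsetP => x.
by rewrite !inE => /andP[/(subsetP SD)-> ->].
Qed.

Lemma colour_countD D S : S \subset D ->
  colour_count (D :\: S) = exp_sub (colour_count D) (colour_count S).
Proof.
move=> SD; apply/ffunP => i; rewrite !ffunE -[in RHS](setIidPr SD).
rewrite [in RHS](_ : [set x in D :&: S | c x == i]%SET =
                     [set x in D | c x == i]%SET :&: S).
  by rewrite -cardsD; apply: eq_card => x; rewrite !inE; do !case: (_ \in _).
by apply/setP => x; rewrite !inE andbAC.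
Qed.

Lemma colour_count_eq0 D : (colour_count D == 0) = (D == finset.set0).
Proof.
apply/eqP/eqP => [D0|->]; last first.
  apply/ffunP => i; rewrite !ffunE; apply: eq_card0 => x.
  by rewrite !inE.
apply/setP => x; rewrite inE; apply/negP => xD.
move/ffunP/(_ (c x))/eqP: D0; rewrite !ffunE; apply/negP.
by rewrite -lt0n; apply/card_gt0P; exists x; rewrite !inE xD eqxx.
Qed.

(** A subset of [D] amounts to an independent choice, for each colour [i], of [a i] elements of the
    colour class [Di i]; the injection [h] cuts a set into these pieces. *)
Lemma card_colour_count D a :
  #|[set S : {set X} | (S \subset D) && (colour_count S == a)]%SET|
    = (\prod_i 'C(colour_count D i, a i))%N.
Proof.
pose Di i := [set x in D | c x == i]%SET.
pose F i := [pred S : {set X} | (S \subset Di i) && (#|S| == a i)].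
pose h (S : {set X}) := [ffun i => [set x in S | c x == i]%SET].
transitivity #|(family F : pred {ffun I -> {set X}})|; last first.
  rewrite card_family foldrE big_image /=; apply: eq_bigr => i _.
  by rewrite ffunE -cards_draws cardsE.
have h_inj : injective h.
  move=> S S' /ffunP e; apply/setP => x; move/setP/(_ x): (e (c x)).
  by rewrite !ffunE !inE eqxx !andbT.
rewrite -(card_imset _ h_inj); apply: eq_card => f.
apply/imsetP/familyP => [[S]|fF].
  rewrite inE => /andP[SD /eqP aE] -> i; rewrite !inE -aE !ffunE eqxx andbT.
  by apply/subsetP => x; rewrite !inE => /andP[/(subsetP SD)-> ->].
(* The pieces lie in disjoint colour classes, so cutting their union by colour gives them back. *)
have fE : f = h (\bigcup_i f i).
  apply/ffunP => i; rewrite ffunE; apply/setP => x; rewrite !inE.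
  apply/idP/andP => [xi|[/bigcupP[j _ xj] /eqP ci]].
    have := fF i; rewrite inE => /andP[/subsetP/(_ x xi)].
    by rewrite inE => /andP[_ ->] _; split=> //; apply/bigcupP; exists i.
  have := fF j; rewrite inE => /andP[/subsetP/(_ x xj)].
  by rewrite inE ci => /andP[_ /eqP ->].
exists (\bigcup_i f i) => //; rewrite inE; apply/andP; split.
  apply/bigcupsP => i _; have := fF i; rewrite inE => /andP[/subsetP fD _].
  by apply/subsetP => x /fD; rewrite inE => /andP[].
apply/eqP/ffunP => i; have := fF i; rewrite inE => /andP[_ /eqP <-].
by rewrite ffunE {2}fE ffunE.
Qed.

End Colouring.

(** * Weighted partitions of a finite set into [K] blocks *)

Section PartitionSums.
Variables (X : finType) (R : comNzRingType) (omega : {set X} -> R).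
Implicit Types D S : {set X}.

Definition partition_sum K D : R :=
  \sum_(m : {set {set X}} | finset.partition m D && (#|m| == K))
    \prod_(S in m) omega S.

Lemma partition_sum0 D : partition_sum 0 D = (D == finset.set0)%:R.
Proof.
rewrite /partition_sum; have [->|D0] := eqVneq D finset.set0.
  rewrite (big_pred1 finset.set0) ?big_set0 // => m.
  by rewrite partition_set0 inE; case: (eqVneq m) => // ->; rewrite cards0.
rewrite big_pred0 // => m; apply/negbTE/negP => /andP[mD].
rewrite cards_eq0 => /eqP m0; move: mD; rewrite m0 => /cover_partition.
by rewrite /cover big_set0 => DE; rewrite DE eqxx in D0.
Qed.

(* Double counting of the pairs (m, S) with S a block of m: removing S from m
   leaves a partition of the complement of S. *)
Lemma partition_sumS K D : omega finset.set0 = 0 ->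
  K.+1%:R * partition_sum K.+1 D =
    \sum_(S : {set X} | S \subset D) omega S * partition_sum K (D :\: S).
Proof.
move=> omega0; rewrite /partition_sum mulr_sumr.
transitivity (\sum_(m : {set {set X}} | finset.partition m D && (#|m| == K.+1))
    \sum_(S in m) omega S * \prod_(S' in m :\ S) omega S').
  apply: eq_bigr => m /andP[_ /eqP mK].
  rewrite -mK mulr_natl -sumr_const; apply: eq_bigr => S Sm.
  by rewrite (big_setD1 S).
rewrite (exchange_big_dep (fun S : {set X} => S \subset D)) /=; last first.
  move=> m S /andP[mD _] Sm; rewrite -(cover_partition mD).
  exact: bigcup_sup.
apply: eq_bigr => S SD.
(* The empty [S] is treated apart: only a nonempty [S] is sure not to be a block of a partition of
   [D :\: S], which makes adding and removing [S] inverse to each other. *)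
have [->|S0] := eqVneq S finset.set0.
  by rewrite omega0 mul0r big1 // => m _; rewrite mul0r.
rewrite mulr_sumr (reindex_onto (fun m => S |: m) (fun m => m :\ S)) /=; last first.
  by move=> m /andP[_ Sm]; rewrite finset.setD1K.
have notin m : finset.partition m (D :\: S) -> S \notin m.
  move=> mDS; apply/negP => Sm; have: S \subset D :\: S.
    by rewrite -(cover_partition mDS); exact: bigcup_sup.
  by rewrite subsetD -setI_eq0 finset.setIid (negbTE S0) andbF.
have UD : S :|: (D :\: S) = D by rewrite -{1}(setIidPr SD) finset.setID.
apply: eq_big => [m|m /andP[_ /eqP->] //].
rewrite setU11 andbT; apply/idP/idP.
  move=> /andP[/andP[mD mK] /eqP mS].
  have Sm : S \notin m by rewrite -mS !inE eqxx.
  have := partitionD1 mD (setU11 _ _); rewrite mS => -> /=.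
  by move: mK; rewrite cardsU1 Sm.
move=> /andP[mDS /eqP mK]; have Sm := notin _ mDS.
rewrite setU1K // eqxx cardsU1 Sm mK eqxx !andbT -UD.
apply: partitionU1 => //.
by rewrite disjoints_subset finset.setDE finset.setCI finset.setCK finset.subsetUr.
Qed.

End PartitionSums.

(** * The exponential formula for coloured sets *)

Section ExponentialFormula.
Variables (I : finType) (R : numFieldType).
Implicit Types (g : {ffun I -> nat} -> R) (N : {ffun I -> nat}).

Definition egf g : fps I R := fun N => g N / (exp_fact N)%:R.

Lemma exp_fact_neq0 N : (exp_fact N)%:R != 0 :> R.
Proof. by rewrite pnatr_eq0 -lt0n exp_fact_gt0. Qed.

(** Subsets are grouped by colour count, and each group has a product of binomials as its size. *)
Lemma sum_colour_count (X : finType) (c : X -> I) (D : {set X}) g :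
  \sum_(S : {set X} | S \subset D) g (colour_count c S) =
  \sum_(b : exp_box (colour_count c D))
    (\prod_i 'C(colour_count c D i, exp_of b i))%:R * g (exp_of b).
Proof.
transitivity (\sum_(b : exp_box (colour_count c D))
    \sum_(S : {set X} | (S \subset D) && (colour_count c S == exp_of b))
    g (exp_of b)); last first.
  apply: eq_bigr => b _; rewrite -card_colour_count mulr_natl -sumr_const.
  by apply: eq_bigl => S; rewrite inE.
rewrite (exchange_big_dep (fun S : {set X} => S \subset D)) /=; last by move=> b S _ /andP[].
apply: eq_bigr => S SD.
have [b bE] := exp_ofP (colour_count_le c SD).
rewrite (big_pred1 b) ?bE // => b'.
by rewrite SD -bE (inj_eq (@exp_of_inj _ _)) eq_sym.
Qed.

(** Induction on [K], for all [D] at once: removing one block on the left matches splitting off one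
    factor [egf g] on the right. *)
Lemma partition_sum_egf (X : finType) (c : X -> I) g K (D : {set X}) : g 0 = 0 ->
  partition_sum (fun S => g (colour_count c S)) K D / (exp_fact (colour_count c D))%:R
    = (K`!%:R^-1 *: egf g ^+ K) (colour_count c D).
Proof.
move=> g0; elim: K D => [|K IH] D.
  rewrite partition_sum0 expr0 fact0 invr1 scale1r -(colour_count_eq0 c).
  rewrite -fps_monom0 /fps_monom; case: eqP => [->|_]; last by rewrite mul0r.
  by rewrite /exp_fact big1 ?divr1 // => i _; rewrite ffunE.
have omega0 : g (colour_count c finset.set0) = 0.
  rewrite (_ : colour_count c finset.set0 = 0) //.
  by apply/eqP; rewrite colour_count_eq0.
have K0 : K.+1%:R != 0 :> R by rewrite pnatr_eq0.
apply: (mulfI K0); rewrite mulrA partition_sumS //.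
(* By induction the sum over the partitions of [D :\: S] depends only on the colour count of [S];
   [h] is the resulting summand. *)
set N := colour_count c D; pose h a := g a * ((exp_fact (exp_sub N a))%:R *
  (K`!%:R^-1 *: egf g ^+ K) (exp_sub N a)).
transitivity ((\sum_(S : {set X} | S \subset D) h (colour_count c S)) /
    (exp_fact N)%:R).
  congr (_ / _); apply: eq_bigr => S SD; congr (_ * _).
  by rewrite -colour_countD // -IH mulrC divfK ?exp_fact_neq0.
rewrite sum_colour_count -/N exprS fps_coefZ fps_coefM factS natrM invfM.
rewrite mulrA mulrA divff // mul1r mulr_suml mulr_sumr; apply: eq_bigr => b _.
(* Writing [N!] as the binomials times [a! (N - a)!] cancels the number of choices of [S] and leaves
   the convolution term [g a / a!] times the coefficient at [N - a]. *)
rewrite /h /egf fps_coefZ (exp_fact_binomial (exp_of_le b)) !natrM.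
have B0 : (\prod_i 'C(N i, exp_of b i))%:R != 0 :> R.
  by rewrite pnatr_eq0 -lt0n prodn_gt0 // => i; rewrite bin_gt0 exp_of_le.
by field; rewrite !exp_fact_neq0 B0 pnatr_eq0 -lt0n fact_gt0.
Qed.

End ExponentialFormula.

(** * Tilings of the blow-up as weighted partitions *)

Section TilingPolynomial.
Variables (G : sgraph) (R : realType) (T : {fset tile G}) (w : T -> R).
Implicit Type N : {ffun G -> nat}.

(** Extends [w] by 0 to all exponent vectors: at most one tile of [T] has the multiplicities [a], so
    the sum has at most one term. *)
Definition tile_weight (a : {ffun G -> nat}) : R :=
  \sum_(t : T | val (val t) == a) w t.

(** Tiles are nonempty multisets. This supplies the hypothesis [g 0 = 0] of the exponential
    formula. *)
Lemma tile_weight0 : tile_weight 0 = 0.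
Proof.
rewrite /tile_weight big_pred0 // => t; apply/negbTE/negP => /eqP t0.
by have /existsP[v] := valP (val t); rewrite t0 ffunE.
Qed.

Lemma tiling_polynomialE : tiling_polynomial w = egf tile_weight.
Proof.
apply/funext => N; rewrite /tiling_polynomial fps_coef_sum /egf /tile_weight mulr_suml.
rewrite [RHS]big_mkcond /=; apply: eq_bigr => t _.
rewrite scaler_prod -fps_monomE !fps_coefZ /fps_monom eq_sym.
case: eqP => [<-|_]; last by rewrite !mulr0.
by rewrite mulr1 /exp_fact prodfV -natr_prod.
Qed.

Lemma is_liftE N (t : tile G) (S : {set blowup N}) :
  is_lift t S = (val t == colour_count (@above G N) S).
Proof.
apply/forallP/eqP => [tS|-> v]; last by rewrite ffunE.
by apply/ffunP => v; rewrite ffunE (eqP (tS v)).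
Qed.

Lemma colour_count_blowup N : colour_count (@above G N) [set: blowup N]%SET = N.
Proof.
apply/ffunP => v; rewrite ffunE.
(* The fibre above [v] is the injective image of ['I_(N v)]. *)
have <- : #|[set Tagged (fun v => 'I_(N v)) i | i in 'I_(N v)]%SET| = N v.
  rewrite card_imset ?card_ord // => i j /eqP.
  by rewrite eq_Tagged => /eqP.
apply: eq_card => -[u i]; rewrite !inE /=; apply/eqP/imsetP => [e|[j _ /(congr1 tag)] //].
by rewrite /above /= in e; case: v / e; exists i.
Qed.

(** Each block of a tiling is a lift of exactly one tile of [T], so the product over tiles can be
    regrouped block by block. *)
Lemma tiling_weightE N (m : {set {set blowup N}}) : m \in tilings N T ->
  tiling_weight w m = \prod_(S in m) tile_weight (colour_count (@above G N) S).
Proof.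
rewrite inE => /andP[_ /'forall_implyP mT].
rewrite /tiling_weight /tile_count.
transitivity (\prod_(t : T) \prod_(S in m | is_lift (val t) S) w t).
  apply: eq_bigr => t _; rewrite -prodr_const; apply: eq_bigl => S.
  by rewrite inE.
rewrite (exchange_big_dep [in m]) /=; last by move=> t S _ /andP[].
apply: eq_bigr => S Sm; have /existsP[t tS] := mT _ Sm.
have tE (u : T) : (val (val u) == colour_count (@above G N) S) = (u == t).
  by move: tS; rewrite is_liftE => /eqP <-; rewrite !(inj_eq val_inj).
rewrite /tile_weight (eq_bigl _ _ tE) big_pred1_eq (big_pred1 t) // => u.
by rewrite is_liftE tE Sm.
Qed.

(** A partition with a block that lifts no tile of [T] contributes 0, as [tile_weight] vanishes on
    that block; the tilings remain. *)
Lemma partition_function_cardE K N : partition_function_card w K N =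
  partition_sum (fun S => tile_weight (colour_count (@above G N) S)) K [set: blowup N]%SET.
Proof.
rewrite /partition_function_card /partition_sum.
rewrite [RHS](bigID (fun m : {set {set blowup N}} =>
  [forall S in m, exists t : T, is_lift (val t) S])) /=.
rewrite [X in _ + X]big1 ?addr0 => [|m /andP[_]]; last first.
  rewrite negb_forall_in => /existsP[S /andP[Sm /existsPn nS]].
  rewrite (bigD1 S) //= {1}/tile_weight [X in X * _]big_pred0 ?mul0r // => t.
  by have := nS t; rewrite is_liftE => /negbTE.
apply: eq_big => [m|m /andP[mT _]]; last exact: tiling_weightE.
by rewrite inE andbAC.
Qed.

Lemma tiling_polynomialX K N :
  (K`!%:R^-1 *: tiling_polynomial w ^+ K) N =
    partition_function_card w K N / (\prod_(v : G) (N v)`!)%:R.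
Proof.
have := partition_sum_egf (@above G N) K [set: blowup N]%SET tile_weight0.
by rewrite colour_count_blowup partition_function_cardE tiling_polynomialE => <-.
Qed.

Lemma partition_functionE N : partition_function w N =
  \sum_(K < #|{set blowup N}|.+1) partition_function_card w K N.
Proof.
rewrite /partition_function.
rewrite (partition_big (fun m : {set {set blowup N}} =>
  (* A tiling is a set of subsets of the blow-up, so the number of all subsets bounds its size and
     [inord] loses nothing. *)
  inord #|m| : 'I_#|{set blowup N}|.+1) xpredT) //=.
apply: eq_bigr => K _; apply: eq_bigl => m.
by rewrite -val_eqE /= inordK // ltnS max_card.
Qed.

Lemma fps_exp_tiling_polynomial N : fps_exp (tiling_polynomial w) N =
  partition_function w N / (\prod_(v : G) (N v)`!)%:R.
Proof.
rewrite /fps_exp partition_functionE mulr_suml.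
under eq_fsbigr do rewrite tiling_polynomialX.
rewrite (fsbig_ord _ _ (fun K => partition_function_card w K N / _)).
(* Beyond that bound no tiling has [K] blocks, so the sum over all [K] reduces to a finite range. *)
apply/esym/fsbig_widen => // K [_ /= /negP]; rewrite -leqNgt => ltK.
rewrite /partition_function_card [X in X / _]big_pred0 ?mul0r // => m; apply/negbTE/negP.
by move=> /andP[_ /eqP mK]; rewrite -mK ltnNge max_card in ltK.
Qed.

End TilingPolynomial.

Theorem theorem2p1 (R : realType) (G : sgraph) (T : {fset tile G}) (w : T -> R)
    (w_gt0 : forall t : T, 0 < w t) :
  fps_exp (tiling_polynomial w) =
    (fun N : {ffun G -> nat} =>
       partition_function w N / (\prod_(v : G) (N v)`!)%:R)
  /\ forall K : nat,
  K`!%:R^-1 *: tiling_polynomial w ^+ K =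
    (fun N : {ffun G -> nat} =>
       partition_function_card w K N / (\prod_(v : G) (N v)`!)%:R).
Proof.
split=> [|K]; apply/funext => N.
  exact: fps_exp_tiling_polynomial.
exact: tiling_polynomialX.
Qed.
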